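(* Let $(B,\lambda)$ and $(F,\tau)$ be Lefschetz algebras. Let $E=\bigoplus_{i=0}^e E^i$ be an $\mathbb{N}$-graded Artinian $\mathbb{R}$-algebra equipped with graded (degree-zero) $\mathbb{R}$-algebra homomorphisms $\pi\colon B\to E$ and $\iota\colon E\to F$. Suppose that (1) $E$ is a free $B$-module via $\pi$, and (2) $\iota$ is surjective with $\ker(\iota)=B^+\cdot E$, where $B^+=\bigoplus_{i>0}B^i$ and $B^+\cdot E$ denotes the ideal of $E$ generated by $\pi(B^+)$. Then for any $x\in E^1$ with $\iota(x)=\tau$, there exists $t\in\mathbb{R}$ such that the pair $(E,\pi(\lambda)+tx)$ is a Lefschetz algebra.
   Context: An $\mathbb{N}$-graded Artinian $\mathbb{R}$-algebra is a commutative graded finite-dimensional $\mathbb{R}$-algebra $R=\bigoplus_{i=0}^r R^i$ with $R^0=\mathbb{R}$, where $r$ denotes the top degree ($R^r\ne 0$). A Lefschetz element for $R$ is an element $l\in R^1$ such that the multiplication maps $l^{r-2i}\colon R^i\to R^{r-i}$ are isomorphisms for all $0\le i\le\lfloor r/2\rfloor$. A Lefschetz algebra is a pair $(R,l)$ consisting of an $\mathbb{N}$-graded Artinian $\mathbb{R}$-algebra $R$ and a Lefschetz element $l\in R^1$ for $R$. *)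

(* Defs.v *)
From HB Require Import structures.
From mathcomp Require Import all_boot all_order all_algebra all_field.
From mathcomp Require Import reals.

Set Implicit Arguments.
Unset Strict Implicit.
Unset Printing Implicit Defensive.

Import GRing.Theory.
Local Open Scope ring_scope.

(* Finite dimensionality is carried by falgType, whose elements form a nonzero
   ring.  The grading is total on nat, with gr i = 0 above the top degree r. *)
Record graded_artinian (R : realType) (A : falgType R)
    (gr : nat -> {vspace A}) (r : nat) : Prop := GradedArtinian {
  ga_mulC : commutative (@GRing.mul A);
  ga_direct : directv (\sum_(i < r.+1) gr i)%VS;
  ga_full : (\sum_(i < r.+1) gr i)%VS = fullv;
  ga_above : forall i : nat, (r < i)%N -> gr i = 0%VS;
  ga_mul : forall i j : nat, (gr i * gr j <= gr (i + j)%N)%VS;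
  ga_gr0 : gr 0%N = 1%VS;
  ga_top : gr r <> 0%VS
}.

Definition lefschetz_element (R : realType) (A : falgType R)
    (gr : nat -> {vspace A}) (r : nat) (l : A) : Prop :=
  l \in gr 1%N /\
  forall i : nat, (i <= r./2)%N ->
    {in gr i &, injective (amull (l ^+ (r - i.*2)))} /\
    (amull (l ^+ (r - i.*2)) @: gr i)%VS = gr (r - i)%N.

Definition lefschetz_algebra (R : realType) (A : falgType R)
    (gr : nat -> {vspace A}) (r : nat) (l : A) : Prop :=
  graded_artinian gr r /\ lefschetz_element gr r l.

(* The type 'AHom(A, A') already enforces R-linearity, multiplicativity and
   preservation of 1. *)
Definition graded_hom (R : realType) (A A' : falgType R)
    (gr : nat -> {vspace A}) (gr' : nat -> {vspace A'})
    (phi : 'AHom(A, A')) : Prop :=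
  forall i : nat, (phi @: gr i <= gr' i)%VS.

Definition positive_part (R : realType) (A : falgType R)
    (gr : nat -> {vspace A}) (r : nat) : {vspace A} :=
  (\sum_(i < r.+1 | (0 < i)%N) gr i)%VS.

(* S is a basis of E for the B-module structure b . y = pi b * y; neither
   finiteness nor homogeneity of S is required. *)
Definition module_basis_via (R : realType) (B E : falgType R)
    (pi : 'AHom(B, E)) (S : E -> Prop) : Prop :=
  (forall y : E, exists (s : seq E) (c : E -> B),
     (forall v, v \in s -> S v) /\ y = \sum_(v <- s) pi (c v) * v) /\
  (forall (s : seq E) (c : E -> B),
     uniq s -> (forall v, v \in s -> S v) ->
     \sum_(v <- s) pi (c v) * v = 0 -> forall v, v \in s -> c v = 0).

Definition free_module_via (R : realType) (B E : falgType R)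
    (pi : 'AHom(B, E)) : Prop :=
  exists S : E -> Prop, module_basis_via pi S.

(* The span of all products pi b * y with b in B^+ and y in E, which, E being
   commutative, is the ideal of E generated by pi(B^+). *)
Definition extended_positive_ideal (R : realType) (B E : falgType R)
    (grB : nat -> {vspace B}) (b : nat) (pi : 'AHom(B, E)) : {vspace E} :=
  ((pi @: positive_part grB b) * fullv)%VS.

(* Main.v *)
Require Import Defs.
From HB Require Import structures.
From mathcomp Require Import all_boot all_order all_algebra all_field.
From mathcomp Require Import reals.
From mathcomp Require Import ring lra zify.
From mathcomp.real_closed Require Import mxtens.

Set Implicit Arguments.
Unset Strict Implicit.
Unset Printing Implicit Defensive.

Import Order.TTheory GRing.Theory Num.Theory.
Local Open Scope ring_scope.

(* If b_i is a homogeneous basis of B and y_j are homogeneous lifts to E of a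
   homogeneous basis of F, then the products pi(b_i) y_j form a basis of E: they
   span by graded Nakayama, and freeness gives dim E >= dim B * dim F.  In this
   basis lambda acts as A (x) 1, while x acts as 1 (x) C plus terms that strictly
   raise the degree in B, where A and C are the matrices of lambda and tau.
   Rescaling by powers of s along the degree in B turns lambda + s x into
   s (A (x) 1 + 1 (x) C + O(s)), with a remainder polynomial in s, so all but
   finitely many s work once A (x) 1 + 1 (x) C is Lefschetz.

   The latter holds because a degree-one operator e on a graded space with
   weight operator H is Lefschetz if and only if f e - e f = H for some f
   lowering the degree, and such f add up on tensor products.  For the direct
   implication, H lies in the image of ad e because it is trace-orthogonal to
   every Y commuting with e: the powers of e identify the traces of Y on opposite
   degrees, whose weights are opposite. *)

(** * The hard Lefschetz property from a lowering operator *)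

Lemma natr_doubleS (K : pzSemiRingType) j : j.+1.*2%:R = j.*2%:R + 2%:R :> K.
Proof. by rewrite -natrD addn2. Qed.

Section Sl2.
Variables (K : realFieldType) (n N : nat) (e f h : 'M[K]_n).
Hypothesis comm_fe : f *m e - e *m f = h.
Hypothesis comm_eh : e *m h = h *m e + 2%:R *: e.
Hypothesis comm_fh : f *m h = h *m f - 2%:R *: f.
Hypothesis wt_bound :
  forall (c : K) (u : 'rV_n), N%:R < `|c| -> u *m h = c *: u -> u = 0.

(** Matrices act on rows from the right, so these are the lowest weight vectors: eigenvectors of [h]
    killed by the lowering operator [f]. *)
Let prim (c : K) (p : 'rV[K]_n) := p *m h = c *: p /\ p *m f = 0.

Let wt_e c (u : 'rV_n) : u *m h = c *: u -> (u *m e) *m h = (c + 2%:R) *: (u *m e).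
Proof.
by move=> uh; rewrite -mulmxA comm_eh mulmxDr mulmxA uh -scalemxAl -scalemxAr scalerDl.
Qed.

Let wt_f c (u : 'rV_n) : u *m h = c *: u -> (u *m f) *m h = (c - 2%:R) *: (u *m f).
Proof.
by move=> uh; rewrite -mulmxA comm_fh mulmxBr mulmxA uh -scalemxAl -scalemxAr scalerBl.
Qed.

Let mulmx_expS (u : 'rV[K]_n) j : u *m e ^+ j.+1 = (u *m e ^+ j) *m e.
Proof. by rewrite exprSr; apply: mulmxA. Qed.

Let mulmx_exp0 (u : 'rV[K]_n) : u *m e ^+ 0 = u.
Proof. exact: mulmx1. Qed.

Let wt_eX c (u : 'rV_n) j :
  u *m h = c *: u -> (u *m e ^+ j) *m h = (c + j.*2%:R) *: (u *m e ^+ j).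
Proof.
move=> uh; elim: j => [|j IHj]; first by rewrite mulmx_exp0 addr0.
by rewrite mulmx_expS (wt_e IHj) natr_doubleS -addrA.
Qed.

(** Moving [f] to the left past each [e] contributes the terms -(c + 2i) for i = 0, ..., j, which
    sum to the coefficient. *)
Let prim_f c p j : prim c p ->
  (p *m e ^+ j.+1) *m f = (j.+1%:R * (- c - j%:R)) *: (p *m e ^+ j).
Proof.
move=> [ph pf]; have ef : e *m f = f *m e - h by rewrite -comm_fe opprB addrC subrK.
elim: j => [|j IHj].
  rewrite mulmx_expS mulmx_exp0 -mulmxA ef mulmxBr mulmxA pf mul0mx ph sub0r.
  by rewrite -scaleNr; congr (_ *: _); ring.
rewrite mulmx_expS -mulmxA ef mulmxBr [_ *m (f *m e)]mulmxA IHj -scalemxAl.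
rewrite -mulmx_expS (wt_eX _ ph) -scalerBl; congr (_ *: _).
by rewrite -muln2 natrM -!natr1; ring.
Qed.

(** For c > 0 the coefficients in [prim_f] never vanish, so p e^j = 0 descends to p = 0; a high
    power does vanish by the weight bound. *)
Let prim_pos (c : K) p : 0 < c -> prim c p -> p = 0.
Proof.
move=> c_gt0 pp; have step j : p *m e ^+ j.+1 = 0 -> p *m e ^+ j = 0.
  move=> pe0; have := prim_f j pp; rewrite pe0 mul0mx => /esym/eqP.
  rewrite scaler_eq0 => /orP[|/eqP//]; rewrite mulf_eq0 pnatr_eq0 -opprD oppr_eq0 /=.
  by rewrite gt_eqF// ltr_pwDl.
have : p *m e ^+ N.+1 = 0.
  apply: (wt_bound _ (wt_eX _ pp.1)); rewrite ger0_norm ?addr_ge0// ?ltW//.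
  by rewrite ltr_wpDl ?ltr_nat // ?ltW// -addnn; lia.
by elim: N.+1 => [|j IHj /step//]; rewrite mulmx_exp0.
Qed.

(** Applying [e] once more kills the term j = 0, since p_0 e^(k+1) is primitive of weight k + 2 > 0.
    The other terms have the same shape with k + 2 for k. Then p_0 e^k = 0 descends to p_0 = 0, as j
    - k is nonzero for j < k. *)
Let prim_sum_inj m k (p : nat -> 'rV_n) :
  (forall j, prim (- (k + j.*2)%:R) (p j)) ->
  \sum_(j < m) p j *m e ^+ (k + j) = 0 -> forall j, (j < m)%N -> p j = 0.
Proof.
elim: m k p => // m IHm k p pp; rewrite big_ord_recl /= addn0 => sum0.
have p0e : p 0 *m e ^+ k.+1 = 0.
  apply: (@prim_pos (- (k + 0)%:R + k.+1.*2%:R)).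
    by rewrite addrC subr_gt0 ltr_nat -addnn; lia.
  split; first by apply: wt_eX; case: (pp 0).
  by rewrite (prim_f _ (pp 0)) opprK addn0 subrr mulr0 scale0r.
have pS j : (j < m)%N -> p j.+1 = 0.
  apply: (IHm k.+2 (fun j => p j.+1)) => [i|].
    by have := pp i.+1; rewrite doubleS !addnS.
  have := congr1 (mulmx^~ e) sum0; rewrite mulmxDl mul0mx -mulmx_expS p0e add0r.
  rewrite mulmx_suml => s0; rewrite -[RHS]s0; apply: eq_bigr => i _.
  by rewrite -mulmx_expS /bump /= add1n addnS.
have {}p0e : p 0 *m e ^+ k = 0.
  by move: sum0; rewrite big1 ?addr0// => i _; rewrite pS// mul0mx.
case=> [_|j]; last exact: pS.
have: forall j, (j <= k)%N -> p 0 *m e ^+ j = 0 -> p 0 = 0.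
  elim=> [|j IHj] lejk; first by rewrite mulmx_exp0.
  move=> pe0; apply: IHj; first exact: ltnW.
  have := prim_f j (pp 0); rewrite pe0 mul0mx => /esym/eqP.
  rewrite scaler_eq0 => /orP[|/eqP//]; rewrite mulf_eq0 pnatr_eq0 opprK addn0.
  by rewrite subr_eq0 eqr_nat (gtn_eqF lejk).
by apply; [exact: leqnn|].
Qed.

(** Induction on the number [d] of steps down to weight -N: decompose v f, find u with u e f = v f,
    and observe that v - u e is primitive. *)
Let prim_decomp d k (v : 'rV_n) : (k + d.*2 = N)%N -> v *m h = - k%:R *: v ->
  exists2 p : nat -> 'rV_n, forall j, prim (- (k + j.*2)%:R) (p j)
    & v = \sum_(j < d.+1) p j *m e ^+ j.
Proof.
elim: d k v => [|d IHd] k v kdN vh.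
  have vf : v *m f = 0.
    apply: (wt_bound _ (wt_f vh)); rewrite -opprD normrN -natrD normr_nat ltr_nat.
    by lia.
  exists (fun j => if j == 0 then v else 0) => [[|j]|].
  - by rewrite addn0; split.
  - by split; rewrite mul0mx ?scaler0.
  - by rewrite big_ord1 mulmx_exp0.
have vfh : (v *m f) *m h = - k.+2%:R *: (v *m f).
  by rewrite (wt_f vh) -opprD -natrD addn2.
have [|p pp vfE] := IHd _ _ _ vfh; first by rewrite -kdN doubleS; lia.
(* By [prim_f], this is the factor with which [f] takes (p j) e^(j+1) back to (p j) e^j. *)
pose c j : K := j.+1%:R * (k.+2 + j)%:R.
have c_neq0 j : c j != 0 by rewrite mulf_neq0 ?pnatr_eq0.
have pS j : prim (- (k + j.+1.*2)%:R) ((c j)^-1 *: p j).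
  have [ph pf] := pp j; have kj : (k.+2 + j.*2 = k + j.+1.*2)%N by lia.
  rewrite -kj; split; last by rewrite -scalemxAl pf scaler0.
  by rewrite -scalemxAl ph !scalerA mulrC.
pose u := \sum_(j < d.+1) ((c j)^-1 *: p j) *m e ^+ j.
have uef : u *m e *m f = v *m f.
  rewrite vfE !mulmx_suml; apply: eq_bigr => j _.
  rewrite -mulmx_expS (prim_f _ (pS j)) -scalemxAl scalerA.
  rewrite (_ : _ * _ = 1) ?scale1r//; rewrite opprK -natrB ?leq_add//; last by lia.
  rewrite (_ : (_ - _ = k.+2 + j)%N) ?mulfV ?c_neq0//.
  by rewrite doubleS -addnn; lia.
have uh : u *m h = - k.+2%:R *: u.
  rewrite mulmx_suml scaler_sumr; apply: eq_bigr => j _.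
  rewrite (wt_eX _ (pS j).1); congr (_ *: _).
  by rewrite !natrD natr_doubleS -[k.+2]addn2 natrD; ring.
exists (fun j => if j is j'.+1 then (c j')^-1 *: p j' else v - u *m e).
  case=> [|j]; last exact: pS.
  split; last by rewrite mulmxBl uef subrr.
  rewrite addn0 mulmxBl vh (wt_e uh) scalerBr; congr (_ - _ *: _).
  by rewrite -addn2 natrD opprD subrK.
rewrite big_ord_recl /= mulmx_exp0 [X in _ + X](_ : _ = u *m e) ?subrK//.
by rewrite mulmx_suml; apply: eq_bigr => i _; rewrite /bump /= add1n mulmx_expS.
Qed.

Lemma sl2_exp_inj k d (v : 'rV_n) : (k + d.*2 = N)%N -> v *m h = - k%:R *: v ->
  v *m e ^+ k = 0 -> v = 0.
Proof.
move=> kdN vh vek; have [p pp vE] := prim_decomp kdN vh.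
rewrite vE big1// => j _; rewrite (@prim_sum_inj d.+1 k p)// ?mul0mx//.
rewrite -[RHS]vek vE mulmx_suml; apply: eq_bigr => i _.
by rewrite -mulmxA addnC exprD.
Qed.

End Sl2.

(** * Matrices over an index set with degrees *)

Section GradedMatrix.
Variables (K : realFieldType) (n : nat) (d : 'I_n -> nat).
Implicit Types (N k p : nat) (c : K) (u : 'rV[K]_n) (e f : 'M[K]_n).

Definition homogeneous_row k (u : 'rV[K]_n) := forall i, d i != k -> u 0 i = 0.

Definition raises_degree (A : 'M[K]_n) := forall i j, A i j != 0 -> d j = (d i).+1.

Definition lowers_degree (A : 'M[K]_n) := forall i j, A i j != 0 -> d i = (d j).+1.

Definition weight_mx N : 'M[K]_n := diag_mx (\row_i ((d i).*2%:R - N%:R)).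

Definition sl2_pair N (e f : 'M[K]_n) :=
  [/\ raises_degree e, lowers_degree f & f *m e - e *m f = weight_mx N].

Lemma mul_weight_mx N (u : 'rV_n) i :
  (u *m weight_mx N) 0 i = ((d i).*2%:R - N%:R) * u 0 i.
Proof. by rewrite mul_mx_diag !mxE mulrC. Qed.

Lemma homogeneous_row_weight N k u :
  homogeneous_row k u -> u *m weight_mx N = (k.*2%:R - N%:R) *: u.
Proof.
move=> uk; apply/rowP => i; rewrite mul_weight_mx mxE.
by have [->//|/uk->] := eqVneq (d i) k; rewrite !mulr0.
Qed.

Lemma raises_degree_weight N e : raises_degree e ->
  e *m weight_mx N = weight_mx N *m e + 2%:R *: e.
Proof.
move=> eP; apply/matrixP => i j; rewrite mul_mx_diag mul_diag_mx !mxE.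
have [->|/eP->] := eqVneq (e i j) 0; first by rewrite !(mulr0, mul0r, addr0).
by rewrite natr_doubleS; ring.
Qed.

Lemma lowers_degree_weight N f : lowers_degree f ->
  f *m weight_mx N = weight_mx N *m f - 2%:R *: f.
Proof.
move=> fP; apply/matrixP => i j; rewrite mul_mx_diag mul_diag_mx !mxE.
have [->|/fP->] := eqVneq (f i j) 0; first by rewrite !(mulr0, mul0r, subr0).
by rewrite natr_doubleS; ring.
Qed.

Lemma weight_mx_bound N c u : (forall i, (d i <= N)%N) -> N%:R < `|c| ->
  u *m weight_mx N = c *: u -> u = 0.
Proof.
move=> dN cN /rowP uh; apply/rowP => i; have := uh i.
rewrite mul_weight_mx !mxE => /eqP; rewrite -subr_eq0 -mulrBl mulf_eq0.
case/orP => [|/eqP//]; rewrite subr_eq0 => /eqP cE; move: cN.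
rewrite -cE real_ltNge ?num_real//= ler_norml.
have := dN i; rewrite -(ler_nat K) -muln2 natrM => dNi.
have := ler0n K (d i); have := ler0n K N; move: dNi.
by move: (d i)%:R N%:R => x y; lra.
Qed.

Lemma sl2_pair_raise_inj N e f k p u : (forall i, (d i <= N)%N) ->
  sl2_pair N e f -> (k + p.*2 = N)%N -> homogeneous_row p u ->
  u *m e ^+ k = 0 -> u = 0.
Proof.
move=> dN [eP fP ef] kpN up; apply: (sl2_exp_inj ef _ _ _ kpN).
- exact: raises_degree_weight.
- exact: lowers_degree_weight.
- by move=> c v; apply: weight_mx_bound.
by rewrite (homogeneous_row_weight _ up) -kpN natrD opprD addrC subrK.
Qed.

(** Exchanging [e] with [f] and negating the weight operator preserves the relations, so
    [sl2_exp_inj] applies to [f]. This later gives the dimension bounds. *)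
Lemma sl2_pair_lower_inj N e f k p u : (forall i, (d i <= N)%N) ->
  sl2_pair N e f -> (k + p.*2 = N)%N -> homogeneous_row (p + k) u ->
  u *m f ^+ k = 0 -> u = 0.
Proof.
move=> dN [eP fP ef] kpN up.
have fe : e *m f - f *m e = - weight_mx N by rewrite -ef opprB.
apply: (sl2_exp_inj fe _ _ _ kpN).
- by rewrite mulmxN mulNmx (lowers_degree_weight _ fP) opprB addrC.
- by rewrite mulmxN mulNmx (raises_degree_weight _ eP) opprD.
- move=> c v cN; rewrite mulmxN -scaleN1r => /(congr1 ( *:%R (-1))).
  rewrite !scalerA mulrNN mulr1 scale1r mulN1r.
  by apply: weight_mx_bound; rewrite ?normrN.
rewrite mulmxN (homogeneous_row_weight _ up) -scaleNr -kpN; congr (_ *: _).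
by rewrite doubleD -!addnn !natrD; ring.
Qed.

Definition degree_proj p : 'M[K]_n := diag_mx (\row_i (d i == p)%:R).

Lemma mul_degree_proj p (u : 'rV_n) i :
  (u *m degree_proj p) 0 i = (d i == p)%:R * u 0 i.
Proof. by rewrite mul_mx_diag !mxE mulrC. Qed.

Lemma homogeneous_degree_proj p u : homogeneous_row p (u *m degree_proj p).
Proof. by move=> i /negPf dip; rewrite mul_degree_proj dip mul0r. Qed.

Lemma homogeneous_rowE p u : homogeneous_row p u -> u *m degree_proj p = u.
Proof.
move=> up; apply/rowP => i; rewrite mul_degree_proj.
by case: eqP => [|/eqP/up->]; rewrite ?mul1r ?mulr0.
Qed.

Lemma degree_proj_id p : degree_proj p *m degree_proj p = degree_proj p.
Proof.
rewrite mulmx_diag; congr diag_mx; apply/rowP => i.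
by rewrite !mxE -natrM mulnb andbb.
Qed.

Lemma raises_degree_proj e k p : raises_degree e ->
  degree_proj p *m e ^+ k = e ^+ k *m degree_proj (p + k).
Proof.
move=> eP; elim: k p => [|k IHk] p.
  by rewrite addn0; apply: etrans (mulmx1 _) (esym (mul1mx _)).
have pe : degree_proj p *m e = e *m degree_proj p.+1.
  apply/matrixP => i j; rewrite mul_mx_diag mul_diag_mx !mxE.
  have [->|/eP->] := eqVneq (e i j) 0; first by rewrite mulr0 mul0r.
  by rewrite eqSS mulrC.
rewrite exprS.
change (degree_proj p *m (e *m e ^+ k) = (e *m e ^+ k) *m degree_proj (p + k.+1)).
by rewrite mulmxA pe -mulmxA IHk mulmxA addSnnS.
Qed.

Lemma weight_mx_sum N : (forall i, (d i <= N)%N) ->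
  weight_mx N = \sum_(p < N.+1) (p.*2%:R - N%:R) *: degree_proj p.
Proof.
move=> dN; apply/matrixP => i j; rewrite summxE !mxE.
rewrite (bigD1 (inord (d i)))//= big1 ?addr0 => [|p pd].
  by rewrite !mxE inordK ?ltnS// eqxx mulrnAr mulr1.
rewrite !mxE; case: eqP => [dip|]; last by rewrite mul0rn mulr0.
by case/eqP: pd; apply: val_inj; rewrite /= inordK ?ltnS.
Qed.

End GradedMatrix.

(** * Existence of a lowering operator *)

Section Lowering.
Variables (K : realFieldType) (n : nat) (d : 'I_n -> nat) (N : nat) (A : 'M[K]_n).
Hypothesis dN : forall i, (d i <= N)%N.
Hypothesis Ad : raises_degree d A.
Hypothesis A_inj : forall k p (u : 'rV_n), (k + p.*2 = N)%N ->
  homogeneous_row d p u -> u *m A ^+ k = 0 -> u = 0.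
Hypothesis A_surj : forall k p (w : 'rV_n), (k + p.*2 = N)%N ->
  homogeneous_row d (p + k) w -> exists2 u, homogeneous_row d p u & w = u *m A ^+ k.

Local Notation Pi := (degree_proj K d).

(** A^k identifies degree p with degree p + k and commutes with Y, so the diagonal blocks of Y in
    these two degrees are conjugate. *)
Let mxtrace_proj_half (Y : 'M_n) k p : A *m Y = Y *m A -> (k + p.*2 = N)%N ->
  \tr (Pi (p + k) *m Y) = \tr (Pi p *m Y).
Proof.
move=> AY kpN.
have PA : Pi p *m A ^+ k = A ^+ k *m Pi (p + k) by exact: raises_degree_proj.
have AkY : A ^+ k *m Y = Y *m A ^+ k.
  exact/esym/(@commrX _ Y A k)/esym.
pose M := Pi p *m A ^+ k.
have M_inj (Z : 'M_n) : Z *m M = 0 -> Z *m Pi p = 0.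
  move=> ZM; apply/row_matrixP => i; rewrite row0 row_mul.
  apply: (A_inj kpN); first exact: homogeneous_degree_proj.
  by rewrite -mulmxA -row_mul ZM row0.
have /submxP[G GM] : (Pi (p + k) <= M)%MS.
  apply/row_subP => i; have [|u up ->] := A_surj (w := row i (Pi (p + k))) kpN.
    by rewrite -(degree_proj_id K d) row_mul; apply: homogeneous_degree_proj.
  by rewrite -(homogeneous_rowE up) -mulmxA; apply: submxMl.
have MGP : M *m G *m Pi p = Pi p.
  apply/eqP; rewrite -subr_eq0 -{2}(degree_proj_id K d) -mulmxBl; apply/eqP/M_inj.
  rewrite mulmxBl -mulmxA -GM {1}/M PA -mulmxA degree_proj_id -PA mulmxA.
  by rewrite degree_proj_id subrr.
(* The inverse of A^k, from degree p + k back to degree p. *)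
pose G' := Pi (p + k) *m G *m Pi p.
have G'M : G' *m A ^+ k = Pi (p + k).
  by rewrite -!mulmxA -/M -GM degree_proj_id.
have AG' : A ^+ k *m G' = Pi p.
  by rewrite !mulmxA -PA -/M.
by rewrite -G'M -mulmxA AkY mulmxA mxtrace_mulC mulmxA AG'.
Qed.

Let mxtrace_proj_sym (Y : 'M_n) p : A *m Y = Y *m A -> (p <= N)%N ->
  \tr (Pi (N - p) *m Y) = \tr (Pi p *m Y).
Proof.
move=> AY pN; have [ple|plt] := leqP p.*2 N.
  rewrite -(mxtrace_proj_half (k := N - p.*2) (p := p) AY) ?subnK//.
  by congr (\tr (Pi _ *m _)); lia.
rewrite -[LHS](mxtrace_proj_half (k := N - (N - p).*2) (p := N - p) AY) ?subnK//;
  last by lia.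
by congr (\tr (Pi _ *m _)); lia.
Qed.

(** The reflection p -> N - p preserves the traces and negates the weights, so the sum equals its
    opposite. *)
Let mxtrace_weight (Y : 'M_n) : A *m Y = Y *m A -> \tr (weight_mx K d N *m Y) = 0.
Proof.
move=> AY; rewrite weight_mx_sum// mulmx_suml raddf_sum /=.
rewrite (eq_bigr (fun p : 'I_N.+1 => (p.*2%:R - N%:R) * \tr (Pi p *m Y))); last first.
  by move=> p _; rewrite -scalemxAl mxtraceZ.
set S := BIG_F; have : \sum_p S p = - \sum_p S p.
  rewrite {1}(reindex_inj rev_ord_inj) -sumrN; apply: eq_bigr => p _.
  have pN : (p <= N)%N by rewrite -ltnS.
  rewrite /S /= subSS mxtrace_proj_sym// -mulNr; congr (_ * _).
  by rewrite -!addnn !natrD natrB//; ring.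
by move/eqP; rewrite -subr_eq0 opprK -mulr2n mulrn_eq0 => /eqP.
Qed.

(** Turns a linear functional on matrices, given by the column [c], into a trace pairing. *)
Let mxtrace_mulE (X : 'M[K]_n) (c : 'cV_(n * n)) :
  \tr (X *m (vec_mx c^T)^T) = (mxvec X *m c) 0 0.
Proof.
rewrite mxE (reindex _ (curry_mxvec_bij n n)) /=.
rewrite (eq_bigr (fun ij => X ij.1 ij.2 * c (mxvec_index ij.1 ij.2) 0)).
  rewrite -(pair_bigA _ (fun i j => X i j * c (mxvec_index i j) 0)) /=.
  by apply: eq_bigr => i _; rewrite mxE; apply: eq_bigr => j _; rewrite !mxE.
by case=> i j _; rewrite mxvecE.
Qed.

(** A functional vanishing on the image of L -> L A - A L is the trace pairing with some Y commuting
    with A, and [mxtrace_weight] shows that it also vanishes on the weight matrix. *)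
Let weight_mx_ad : exists L : 'M_n, L *m A - A *m L = weight_mx K d N.
Proof.
pose ad := lin_mx (mulmxr A \- mulmx A).
suff /submxP[l lE] : (mxvec (weight_mx K d N) <= ad)%MS.
  exists (vec_mx l); apply: (can_inj mxvecK).
  by rewrite lE -[l in RHS]vec_mxK /ad mul_vec_lin.
rewrite submxE; apply/eqP/rowP => j; rewrite [RHS]mxE.
pose c := col j (cokermx ad); have ad_c : ad *m c = 0.
  by rewrite /c colE mulmxA mulmx_coker mul0mx.
transitivity ((mxvec (weight_mx K d N) *m c) 0 0).
  by rewrite !mxE; apply: eq_bigr => i _; rewrite [c _ _]mxE.
rewrite -mxtrace_mulE; apply: mxtrace_weight; set Y := _^T.
have trY X : \tr (X *m (A *m Y - Y *m A)) = 0.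
  transitivity (\tr ((X *m A - A *m X) *m Y)).
    rewrite mulmxBr mulmxBl !raddfB /= !mulmxA; congr (_ - _).
    by rewrite mxtrace_mulC mulmxA.
  rewrite mxtrace_mulE -(mul_vec_lin (mulmxr A \- mulmx A)) -mulmxA.
  by rewrite ad_c mulmx0 mxE.
apply/eqP; rewrite -subr_eq0; apply/eqP/matrixP => i k; rewrite [RHS]mxE.
have := trY (delta_mx k i); rewrite -(mul_delta_mx (0 : 'I_1)) -mulmxA.
by rewrite mxtrace_mulC trace_mx11 -rowE -colE !mxE.
Qed.

(* A solution of [L A - A L = H] need not be homogeneous, but its component of
   degree -1 is again a solution. *)
Lemma lefschetz_sl2_pair : exists f, sl2_pair d N A f.
Proof.
have [L LE] := weight_mx_ad.
pose f : 'M_n := \matrix_(i, j) (if d i == (d j).+1 then L i j else 0).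
exists f; split=> //.
  by move=> i j; rewrite mxE; case: (d i =P _) => // _; rewrite eqxx.
apply/matrixP => i j; rewrite -LE !mxE; have [dij|dij] := eqVneq (d i) (d j).
  congr (_ - _); apply: eq_bigr => k _; rewrite mxE.
    by have [->|/Ad dj] := eqVneq (A k j) 0; rewrite ?mulr0// dij dj eqxx.
  by have [->|/Ad dk] := eqVneq (A i k) 0; rewrite ?mul0r// dk dij eqxx.
have := congr1 (fun M : 'M_n => M i j) LE; rewrite !mxE.
have -> : (i == j) = false by apply: contraNF dij => /eqP->.
move=> ->; rewrite !big1 ?subrr// => k _; rewrite mxE.
  by have [->|/Ad dk] := eqVneq (A i k) 0; rewrite ?mul0r// dk eqSS (negPf dij) mulr0.
by have [->|/Ad dj] := eqVneq (A k j) 0; rewrite ?mulr0// -dj (negPf dij) mul0r.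
Qed.

End Lowering.

(** * Tensor products and degenerations *)

(** Operators on different factors commute, so the mixed terms of the commutator cancel and the
    weights add. *)
Lemma sl2_pair_tens (K : realFieldType) m n (d1 : 'I_m -> nat) (d2 : 'I_n -> nat)
    N1 N2 (e1 f1 : 'M[K]_m) (e2 f2 : 'M[K]_n) :
  sl2_pair d1 N1 e1 f1 -> sl2_pair d2 N2 e2 f2 ->
  sl2_pair (fun k => d1 (mxtens_unindex k).1 + d2 (mxtens_unindex k).2)%N (N1 + N2)
    (e1 *t 1%:M + 1%:M *t e2) (f1 *t 1%:M + 1%:M *t f2).
Proof.
move=> [e1d f1d ef1] [e2d f2d ef2].
have tens1 (p q : nat) (A : 'M[K]_p) (B : 'M[K]_q) (i j : 'I_(p * q)) :
    (A *t 1%:M + 1%:M *t B) i j != 0 ->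
    (A (mxtens_unindex i).1 (mxtens_unindex j).1 != 0
      /\ (mxtens_unindex i).2 = (mxtens_unindex j).2)
    \/ (B (mxtens_unindex i).2 (mxtens_unindex j).2 != 0
      /\ (mxtens_unindex i).1 = (mxtens_unindex j).1).
  rewrite !mxE; set a := A _ _; set c := B _ _.
  have [i2|_] := eqVneq (mxtens_unindex i).2 (mxtens_unindex j).2; last first.
    rewrite mulr0n mulr0 add0r.
    have [i1|_] := eqVneq (mxtens_unindex i).1 _; last by rewrite mulr0n mul0r eqxx.
    by rewrite mulr1n mul1r; right.
  have [i1|_] := eqVneq (mxtens_unindex i).1 (mxtens_unindex j).1; last first.
    by rewrite mulr0n mul0r addr0 mulr1n mulr1; left.
  by have [->|a0] := eqVneq a 0; [rewrite mul0r add0r mulr1n mul1r; right | left].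
split.
- move=> i j /tens1[[/e1d-> ->]|[/e2d-> ->]]; first by rewrite addSn.
  by rewrite addnS.
- move=> i j /tens1[[/f1d-> ->]|[/f2d-> ->]]; first by rewrite addSn.
  by rewrite addnS.
rewrite !mulmxDl !mulmxDr !tensmx_mul !mul1mx !mulmx1.
transitivity ((f1 *m e1 - e1 *m f1) *t 1%:M + 1%:M *t (f2 *m e2 - e2 *m f2)).
  by apply/matrixP => i j; rewrite !mxE; ring.
rewrite ef1 ef2; apply/matrixP => i j.
case: (mxtens_indexP i) => i1 i2; case: (mxtens_indexP j) => j1 j2.
rewrite !mxE !mxtens_indexK /= (can_eq (@mxtens_indexK m n)) xpair_eqE.
case: (i1 == j1); case: (i2 == j2);
  rewrite !(mulr1n, mulr0n, mulr0, mul0r, mulr1, mul1r) ?addr0//.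
by rewrite doubleD !natrD; ring.
Qed.

(** In characteristic zero the integers below [size p] are distinct, and they outnumber the
    roots. *)
Lemma exists_nonroot (K : numFieldType) (p : {poly K}) :
  p != 0 -> exists s, p.[s] != 0.
Proof.
move=> p0; pose rs : seq K := [seq i%:R | i <- iota 0 (size p)].
have [/allP rootp|/allPn[s _ ps]] := boolP (all (root p) rs); last by exists s.
have uniq_rs : uniq rs.
  by rewrite map_inj_uniq ?iota_uniq// => i j /eqP; rewrite eqr_nat => /eqP.
have := max_poly_roots p0 (introT allP rootp) uniq_rs.
by rewrite size_map size_iota ltnn.
Qed.

(** * Transfer of injectivity from a degenerate operator *)

Section Degeneration.
Variables (K : realFieldType) (n : nat) (delta d : 'I_n -> nat) (L1 L2 : 'M[K]_n).
Hypothesis L1_raises : raises_degree delta L1.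
Hypothesis L2_raises : forall i j, L2 i j != 0 -> (delta i <= delta j)%N.

Definition degree_preserving_part : 'M[K]_n :=
  \matrix_(i, j) (if delta i == delta j then L2 i j else 0).

(** The rescaled operator as a polynomial in s. Truncated subtraction is harmless: [L2] vanishes
    where [delta] decreases. *)
Let P : 'M[{poly K}]_n :=
  \matrix_(i, j) ((L1 i j)%:P + 'X^(delta j - delta i) * (L2 i j)%:P).

Let Ps s := map_mx (horner_eval s) P.

Let PsE s i j : Ps s i j = L1 i j + s ^+ (delta j - delta i) * L2 i j.
Proof. by rewrite !mxE /horner_eval !hornerE. Qed.

Let Ps0 : Ps 0 = L1 + degree_preserving_part.
Proof.
apply/matrixP => i j; rewrite PsE !mxE; congr (_ + _).
have [->|/L2_raises leij] := eqVneq (L2 i j) 0; first by rewrite mulr0 if_same.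
case: eqP => [->|/eqP neij]; first by rewrite subnn mul1r.
by rewrite expr0n subn_eq0 leqNgt ltn_neqAle neij leij mul0r.
Qed.

Let map_PX s k : map_mx (horner_eval s) (P ^+ k) = Ps s ^+ k.
Proof.
elim: k => [|k IHk]; first exact: map_mx1.
by rewrite !exprS -IHk; apply: map_mxM.
Qed.

Let map_polyCK s m1 m2 (A : 'M[K]_(m1, m2)) :
  map_mx (horner_eval s) (map_mx polyC A) = A.
Proof. by apply/matrixP => i j; rewrite !mxE /horner_eval hornerC. Qed.

(** With U a basis of degree p, injectivity at s = 0 gives a right inverse G of U (Ps 0)^k. Then det
    (U P^k G) is a polynomial with value 1 at 0, and injectivity holds wherever it is nonzero. *)
Let generic_inj p k :
  (forall u, homogeneous_row d p u ->
     u *m (L1 + degree_preserving_part) ^+ k = 0 -> u = 0) ->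
  exists2 q : {poly K}, q != 0 & forall s, q.[s] != 0 ->
    forall u, homogeneous_row d p u -> u *m Ps s ^+ k = 0 -> u = 0.
Proof.
rewrite -Ps0 => inj0; pose U := row_base (degree_proj K d p).
have U_hom v : homogeneous_row d p (v *m U).
  have /submxP[w ->] : (v *m U <= degree_proj K d p)%MS.
    by apply: submx_trans (submxMl _ _) _; rewrite eq_row_base.
  exact: homogeneous_degree_proj.
have /row_freeP[G UG] : row_free (U *m Ps 0 ^+ k).
  apply: inj_row_free => v; rewrite mulmxA => /(inj0 _ (U_hom v)) vU.
  by apply: (row_free_inj (row_base_free (degree_proj K d p))); rewrite vU mul0mx.
pose Q := map_mx polyC U *m P ^+ k *m map_mx polyC G.
have Qs s : map_mx (horner_eval s) Q = U *m Ps s ^+ k *m G.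
  by rewrite !map_mxM map_PX !map_polyCK.
have detQ s : (\det Q).[s] = \det (U *m Ps s ^+ k *m G).
  by rewrite -Qs det_map_mx.
exists (\det Q).
  apply/eqP => Q0; have := detQ 0; rewrite UG det1 Q0 horner0 => /esym/eqP.
  by rewrite oner_eq0.
move=> s; rewrite detQ -unitfE -unitmxE => unitQ u uh uP.
have /submxP[v uE] : (u <= U)%MS.
  by rewrite eq_row_base -(homogeneous_rowE uh) submxMl.
suff v0 : v = 0 by rewrite uE v0 mul0mx.
rewrite -(mulmxK unitQ v) -[_ *m G]mulmxA (mulmxA v U) -uE mulmxA uP.
by rewrite !mul0mx.
Qed.

(* Conjugating [L1 + s L2] by the diagonal matrix with entries [s ^ delta i]
   turns it into [s] times a matrix depending polynomially on [s], whose value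
   at [s = 0] is [L1 + degree_preserving_part]. *)
Lemma degeneration_inj (M : nat) (k : nat -> nat) :
  (forall p u, (p < M)%N -> homogeneous_row d p u ->
     u *m (L1 + degree_preserving_part) ^+ k p = 0 -> u = 0) ->
  exists s, forall p u, (p < M)%N -> homogeneous_row d p u ->
     u *m (L1 + s *: L2) ^+ k p = 0 -> u = 0.
Proof.
move=> inj0.
have [q q0 qP] : exists2 q : {poly K}, q != 0 & forall s, q.[s] != 0 ->
    forall p u, (p < M)%N -> homogeneous_row d p u -> u *m Ps s ^+ k p = 0 -> u = 0.
  elim: M inj0 => [|M' IHM] inj0; first by exists 1; rewrite ?oner_eq0.
  have [|q q0 qP] := IHM; first by move=> p u pM; apply: inj0; apply: ltnW.
  have [u|r r0 rP] := @generic_inj M' (k M'); first exact: inj0.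
  exists (q * r) => [|s]; first by rewrite mulf_neq0.
  rewrite hornerM mulf_eq0 negb_or => /andP[qs rs] p u.
  by rewrite ltnS leq_eqVlt => /orP[/eqP->|]; [apply: rP|apply: qP].
(* The factor ['X] excludes s = 0, where the conjugating diagonal matrix may be singular. *)
have [s] : exists s, ('X * q).[s] != 0.
  by apply: exists_nonroot; rewrite mulf_neq0 ?polyX_eq0.
rewrite hornerM hornerX mulf_eq0 negb_or => /andP[s0 /qP{qP} sP].
exists s => p u pM uh.
pose Phi : 'M[K]_n := diag_mx (\row_i s ^+ delta i).
have conj : (L1 + s *: L2) *m Phi = s *: (Phi *m Ps s).
  apply/matrixP => i j; rewrite mul_mx_diag mul_diag_mx mxE [RHS]mxE.
  rewrite [X in _ = _ * X]mxE PsE !mxE mulrDl !mulrDr; congr (_ + _).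
    have [->|/L1_raises->] := eqVneq (L1 i j) 0; first by rewrite !(mulr0, mul0r).
    by rewrite exprS; ring.
  have [->|/L2_raises lij] := eqVneq (L2 i j) 0; first by rewrite !(mulr0, mul0r).
  by rewrite -{1}(subnKC lij) exprD; ring.
have conjX j : (L1 + s *: L2) ^+ j *m Phi = s ^+ j *: (Phi *m Ps s ^+ j).
  elim: j => [|j IHj].
    by rewrite scale1r; apply: etrans (mul1mx _) (esym (mulmx1 _)).
  rewrite exprSr (exprSr (Ps s)).
  rewrite -[LHS]mulmxA conj -scalemxAr [in LHS]mulmxA IHj -scalemxAl scalerA -exprS.
  by rewrite -mulmxA.
move=> uL; have uPhi : u *m Phi = 0.
  apply: (sP p) => //.
    by move=> i /uh ui; rewrite mul_mx_diag !mxE ui mul0r.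
  have := congr1 (mulmx^~ Phi) uL; rewrite mul0mx -mulmxA conjX -scalemxAr mulmxA.
  by move/eqP; rewrite scaler_eq0 expf_eq0 (negPf s0) andbF => /eqP.
apply/rowP => i; have /rowP/(_ i) := uPhi; rewrite mul_mx_diag !mxE => /eqP.
by rewrite mulf_eq0 expf_eq0 (negPf s0) andbF orbF => /eqP.
Qed.

End Degeneration.

(** * Homogeneous bases *)

Section Coordinates.
Variables (K : fieldType) (A : vectType K) (n : nat) (X : n.-tuple A).

Definition coords (v : A) : 'rV[K]_n := \row_i coord X i v.

Fact coords_is_linear : linear coords.
Proof. by move=> a u v; apply/rowP => i; rewrite !mxE linearP. Qed.
HB.instance Definition _ := GRing.isSemilinear.Build K A 'rV[K]_n _ coords
  (GRing.semilinear_linear coords_is_linear).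

Definition of_coords (u : 'rV[K]_n) : A := \sum_i u 0 i *: X`_i.

Fact of_coords_is_linear : linear of_coords.
Proof.
move=> a u v; rewrite scaler_sumr -big_split; apply: eq_bigr => i _.
by rewrite !mxE scalerDl scalerA.
Qed.
HB.instance Definition _ := GRing.isSemilinear.Build K 'rV[K]_n A _ of_coords
  (GRing.semilinear_linear of_coords_is_linear).

Definition op_mx (g : 'End(A)) : 'M[K]_n := \matrix_(i, j) coord X j (g X`_i).

Definition mx_op (M : 'M[K]_n) : 'End(A) := linfun (of_coords \o mulmxr M \o coords).

Hypothesis X_basis : basis_of fullv X.

Lemma coordsK : cancel coords of_coords.
Proof.
move=> v; rewrite [RHS](coord_basis X_basis (memvf v)).
by apply: eq_bigr => i _; rewrite mxE.
Qed.

Lemma of_coordsK : cancel of_coords coords.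
Proof.
by move=> u; apply/rowP => i; rewrite mxE coord_sum_free ?(basis_free X_basis).
Qed.

Lemma coords_op (g : 'End(A)) v : coords (g v) = coords v *m op_mx g.
Proof.
rewrite -{1}[v]coordsK /of_coords linear_sum linear_sum; apply/rowP => j.
rewrite summxE mxE; apply: eq_bigr => i _.
by rewrite !linearZ !mxE.
Qed.

Lemma coords_mx_op M v : coords (mx_op M v) = coords v *m M.
Proof. by rewrite lfunE /= of_coordsK. Qed.

End Coordinates.

Lemma coords_mulX (K : fieldType) (A : falgType K) n (X : n.-tuple A) (l v : A) k :
  basis_of fullv X -> coords X (l ^+ k * v) = coords X v *m op_mx X (amull l) ^+ k.
Proof.
move=> XB; elim: k => [|k IHk]; first by rewrite mul1r; apply/esym/mulmx1.
rewrite exprS -mulrA exprSr; have := coords_op XB (amull l) (l ^+ k * v).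
by rewrite lfunE /= => ->; rewrite IHk; apply/esym/mulmxA.
Qed.

(** * Lefschetz elements in homogeneous coordinates *)

Section GradedAlgebra.
Variables (R : realType) (A : falgType R) (gr : nat -> {vspace A}) (r : nat).
Hypothesis gA : graded_artinian gr r.

Definition homogeneous_basis n (X : n.-tuple A) (d : 'I_n -> nat) :=
  basis_of fullv X /\ forall i : 'I_n, X`_i \in gr (d i).

Lemma exists_homogeneous_basis :
  exists n (X : n.-tuple A) (d : 'I_n -> nat), homogeneous_basis X d.
Proof.
pose X := \big[cat/[::]]_(i < r.+1) (vbasis (gr i) : seq A).
have XB : basis_of fullv X.
  rewrite -(ga_full gA); apply: bigcat_basis; first exact: ga_direct.
  by move=> i _; apply: vbasisP.
have X_hom (v : A) : v \in X -> exists k, v \in gr k.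
  rewrite /X; elim/big_rec: _ => // i Y _ IH.
  by rewrite mem_cat => /orP[/vbasis_mem|/IH]; first by exists i.
have /fin_all_exists[d dP] : forall i : 'I_(size X), exists k, (in_tuple X)`_i \in gr k.
  by move=> i; apply/X_hom/mem_nth.
by exists (size X), (in_tuple X), d.
Qed.

Section Basis.
Variables (n : nat) (X : n.-tuple A) (d : 'I_n -> nat).
Hypothesis Xd : homogeneous_basis X d.
Let XB : basis_of fullv X := Xd.1.

Lemma homogeneous_basis_neq0 (i : 'I_n) : X`_i != 0.
Proof. by apply: (free_not0 (basis_free XB)); rewrite mem_nth ?size_tuple. Qed.

Lemma gr_le v k : v \in gr k -> v != 0 -> (k <= r)%N.
Proof.
by move=> vk; rewrite leqNgt; apply: contra => /(ga_above gA) gk; rewrite -memv0 -gk.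
Qed.

Lemma homogeneous_basis_le i : (d i <= r)%N.
Proof. exact: gr_le (Xd.2 i) (homogeneous_basis_neq0 i). Qed.

(** Group the expansion of v by the degrees of the basis vectors. Directness of the grading makes
    every group outside degree k vanish, and freeness then kills its coefficients. *)
Lemma coords_homogeneous k v : v \in gr k -> homogeneous_row d k (coords X v).
Proof.
move=> vk i dik; rewrite mxE.
pose w p := \sum_(j | d j == p) coord X j v *: X`_j.
have wP p : w p \in gr p.
  by apply: rpred_sum => j /eqP <-; apply/rpredZ/Xd.2.
have sum_w : \sum_(p < r.+1) w p = v.
  rewrite [RHS](coord_basis XB (memvf v)) /w.
  rewrite (partition_big (fun j => inord (d j) : 'I_r.+1) xpredT)//=.
  apply: eq_bigr => p _; apply: eq_bigl => j.
  by rewrite -val_eqE /= inordK// ltnS homogeneous_basis_le.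
have sum_v : \sum_(p < r.+1) (if val p == k then v else 0) = v.
  have [->|v0] := eqVneq v 0; first by rewrite big1// => p _; rewrite if_same.
  have kr : (k < r.+1)%N by rewrite ltnS; apply: gr_le vk v0.
  rewrite (bigD1 (Ordinal kr))//= eqxx big1 ?addr0// => p pk.
  by rewrite ifF//; apply: contraNF pk => /eqP pk; apply/eqP/val_inj.
have /directv_sum_independent := ga_direct gA.
move=> /(_ (fun p => w p - (if val p == k then v else 0))) indep.
have dir : (d i < r.+1)%N by rewrite ltnS homogeneous_basis_le.
have : w (d i) - (if d i == k then v else 0) = 0.
  apply: (indep _ _ (Ordinal dir)) => // [p _|]; last first.
    by rewrite sumrB sum_w sum_v subrr.
  by rewrite rpredB//; case: eqP => [->|_]; rewrite ?rpred0.
rewrite (negPf dik) subr0 /w big_mkcond /= => w0.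
have /freeP/(_ (fun j => if d j == d i then coord X j v else 0)) := basis_free XB.
rewrite (eq_bigr (fun j => if d j == d i then coord X j v *: X`_j else 0)) => [|j _].
  by move=> /(_ w0 i); rewrite eqxx.
by case: ifP; rewrite ?scale0r.
Qed.

Lemma of_coords_homogeneous k u : homogeneous_row d k u -> of_coords X u \in gr k.
Proof.
move=> uk; apply: rpred_sum => i _.
have [<-|/uk->] := eqVneq (d i) k; first exact/rpredZ/Xd.2.
by rewrite scale0r rpred0.
Qed.

Lemma gr_mul i j u v : u \in gr i -> v \in gr j -> u * v \in gr (i + j)%N.
Proof. by move=> ui vj; apply: (subvP (ga_mul gA i j)); apply: memv_mul. Qed.

Lemma gr1X l k : l \in gr 1%N -> l ^+ k \in gr k.
Proof.
move=> l1; elim: k => [|k IHk]; first by rewrite (ga_gr0 gA) memv_line.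
by rewrite exprS -add1n gr_mul.
Qed.

Lemma op_mx_raises l : l \in gr 1%N -> raises_degree d (op_mx X (amull l)).
Proof.
move=> l1 i j; rewrite mxE lfunE /= => c0; apply/eqP; apply: contraNT c0 => dj.
have /coords_homogeneous/(_ j) := gr_mul l1 (Xd.2 i).
by rewrite mxE add1n => ->.
Qed.

Lemma lefschetz_element_sl2_pair l : lefschetz_element gr r l ->
  exists f, sl2_pair d r (op_mx X (amull l)) f.
Proof.
move=> [l1 lP]; apply: lefschetz_sl2_pair.
- exact: homogeneous_basis_le.
- exact: op_mx_raises.
- move=> k p u kpr up; rewrite -{1}(of_coordsK XB u) -coords_mulX//.
  have pr : (p <= r./2)%N by lia.
  have [inj _] := lP p pr; rewrite (_ : r - p.*2 = k)%N in inj; last by lia.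
  rewrite -(linear0 (coords X)) => /(can_inj (coordsK XB)) lu.
  rewrite -[u](of_coordsK XB) [of_coords X u](inj _ 0) ?linear0//.
  - exact: of_coords_homogeneous.
  - by rewrite mem0v.
  - by rewrite lfunE /= lu.
- move=> k p w kpr wp.
  have pr : (p <= r./2)%N by lia.
  have [_ surj] := lP p pr.
  have : of_coords X w \in gr (r - p)%N.
    by apply: of_coords_homogeneous; rewrite (_ : r - p = p + k)%N//; lia.
  rewrite -surj (_ : r - p.*2 = k)%N; last by lia.
  move=> /memv_imgP[v vp wE]; exists (coords X v); first exact: coords_homogeneous.
  by rewrite -coords_mulX// -[w](of_coordsK XB) wE lfunE.
Qed.

(** The power f0^k maps degree p + k injectively into degree p. *)
Lemma sl2_pair_dim_le (e0 f0 : 'M[R]_n) k p : sl2_pair d r e0 f0 -> (k + p.*2 = r)%N ->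
  (\dim (gr (p + k)%N) <= \dim (gr p))%N.
Proof.
move=> ef kpr; pose phi := mx_op X (f0 ^+ k).
have f0X u : homogeneous_row d (p + k) u -> homogeneous_row d p (u *m f0 ^+ k).
  have [_ f0d _] := ef; elim: k u {kpr phi} => [|k IHk] u.
    by rewrite addn0 => up; rewrite [u *m _](mulmx1 u).
  move=> uk; rewrite exprS [u *m _](mulmxA u f0); apply: IHk => j dj.
  rewrite mxE big1// => i _.
  have [->|/f0d di] := eqVneq (f0 i j) 0; first by rewrite mulr0.
  by rewrite uk ?mul0r// di addnS eqSS.
have <- : \dim (phi @: gr (p + k)%N) = \dim (gr (p + k)%N).
  apply: limg_dim_eq; apply/eqP; rewrite -subv0; apply/subvP => v.
  rewrite memv_cap memv_ker memv0 => /andP[vk /eqP phiv].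
  suff v0 : coords X v = 0 by rewrite -[v](coordsK XB) v0 linear0.
  apply: (sl2_pair_lower_inj homogeneous_basis_le ef kpr (coords_homogeneous vk)).
  by rewrite -coords_mx_op// -/phi phiv linear0.
apply/dimvS/subvP => _ /memv_imgP[v vk ->].
rewrite -[phi v](coordsK XB) coords_mx_op//.
exact/of_coords_homogeneous/f0X/coords_homogeneous.
Qed.

(** The pair, which may belong to another operator than [l], supplies the dimension inequality that
    makes the injective multiplication maps surjective. *)
Lemma lefschetz_element_of_inj l (e0 f0 : 'M[R]_n) : l \in gr 1%N -> sl2_pair d r e0 f0 ->
  (forall k p u, (k + p.*2 = r)%N -> homogeneous_row d p u ->
     u *m op_mx X (amull l) ^+ k = 0 -> u = 0) ->
  lefschetz_element gr r l.
Proof.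
move=> l1 ef inj; split=> // i ir; set k := (r - i.*2)%N.
have kir : (k + i.*2 = r)%N by rewrite /k; lia.
have injl : {in gr i &, injective (amull (l ^+ k))}.
  move=> u v ui vi; rewrite !lfunE /= => uv; apply/eqP; rewrite -subr_eq0.
  suff w0 : coords X (u - v) = 0 by rewrite -[u - v](coordsK XB) w0 linear0.
  apply: (inj _ _ _ kir); first by apply: coords_homogeneous; rewrite rpredB.
  by rewrite -coords_mulX// mulrBr uv subrr linear0.
split=> //; apply/eqP; rewrite (_ : r - i = i + k)%N; last by lia.
rewrite eqEdim; apply/andP; split.
  apply/subvP => _ /memv_imgP[v vi ->]; rewrite lfunE /= addnC.
  by rewrite gr_mul// gr1X.
rewrite limg_dim_eq; first exact: sl2_pair_dim_le ef kir.
apply/eqP; rewrite -subv0; apply/subvP => v.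
rewrite memv_cap memv_ker memv0 => /andP[vi /eqP lv].
by apply/eqP/injl; rewrite ?mem0v// lv linear0.
Qed.

End Basis.
End GradedAlgebra.

(** * Free extensions *)

Lemma sum_mxtens_index (V : nmodType) m n (g : 'I_(m * n) -> V) :
  \sum_k g k = \sum_i \sum_j g (mxtens_index (i, j)).
Proof.
rewrite pair_bigA (reindex (@mxtens_index m n)) /=; last first.
  by exists (@mxtens_unindex m n) => k _; rewrite (mxtens_indexK, mxtens_unindexK).
by apply: eq_bigr => -[].
Qed.

Section Bundle.
Variables (R : realType) (B F E : falgType R).
Variables (grB : nat -> {vspace B}) (grF : nat -> {vspace F}) (grE : nat -> {vspace E}).
Variables (b f e : nat) (pi : 'AHom(B, E)) (iota : 'AHom(E, F)).
Hypotheses (gB : graded_artinian grB b) (gF : graded_artinian grF f).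
Hypothesis gE : graded_artinian grE e.
Hypothesis pi_graded : graded_hom grB grE pi.
Hypothesis iota_graded : graded_hom grE grF iota.
Hypothesis iota_surj : limg iota = fullv.
Hypothesis iota_ker : lker iota = extended_positive_ideal grB b pi.

Lemma pi_homogeneous k beta : beta \in grB k -> pi beta \in grE k.
Proof. by move=> bk; apply: (subvP (pi_graded k)); apply: memv_img. Qed.

Lemma iota_homogeneous k v : v \in grE k -> iota v \in grF k.
Proof. by move=> vk; apply: (subvP (iota_graded k)); apply: memv_img. Qed.

(** The kernel is spanned by such products, so claims about it reduce to homogeneous coefficients of
    positive degree. *)
Lemma iota_ker_sub (W : {vspace E}) :
  (forall q beta v, (0 < q)%N -> beta \in grB q -> pi beta * v \in W) ->
  (lker iota <= W)%VS.
Proof.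
move=> WP; rewrite iota_ker; apply/prodvP => _ v /memv_imgP[beta bP ->] _.
case/memv_sumP: bP => bs bsP ->; rewrite linear_sum mulr_suml.
by apply: rpred_sum => i i0; apply: (WP i) => //; apply: bsP.
Qed.

Lemma iota_pi_eq0 q beta v : (0 < q)%N -> beta \in grB q -> iota (pi beta * v) = 0.
Proof.
move=> q0 bq; apply/eqP; rewrite -memv_ker iota_ker.
apply: memv_mul; last exact: memvf.
have [->|b0] := eqVneq beta 0; first by rewrite linear0 mem0v.
have qb : (q < b.+1)%N by rewrite ltnS; apply: gr_le gB _ _ bq b0.
by apply: memv_img; apply: (subvP (sumv_sup (Ordinal qb) _ (subvv _))).
Qed.

Variables (m n : nat) (bB : m.-tuple B) (bF : n.-tuple F).
Variables (dB : 'I_m -> nat) (dF : 'I_n -> nat).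
Hypotheses (bBd : homogeneous_basis grB bB dB) (bFd : homogeneous_basis grF bF dF).

(** Keep the degree k component of any preimage: the other components map to degrees in which w has
    no coordinates. *)
Lemma iota_lift k w : w \in grF k -> exists2 v, v \in grE k & iota v = w.
Proof.
move=> wk; have : w \in limg iota by rewrite iota_surj memvf.
move=> /memv_imgP[v _ wE]; have : v \in (\sum_(i < e.+1) grE i)%VS.
  by rewrite (ga_full gE) memvf.
case/memv_sumP => vs vsP vE; exists (\sum_(i < e.+1 | val i == k) vs i).
  by apply: rpred_sum => i /eqP <-; apply: vsP.
apply: (can_inj (coordsK bFd.1)); apply/rowP => j.
have [dj|dj] := eqVneq (dF j) k; last first.
  rewrite !(coords_homogeneous gF bFd _ dj)//.
  by apply/iota_homogeneous/rpred_sum => i /eqP <-; apply: vsP.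
rewrite wE vE !linear_sum !summxE big_mkcond; apply: eq_bigr => i _.
case: eqVneq => // ik; rewrite (coords_homogeneous gF bFd (k := i))//.
  by apply: iota_homogeneous; apply: vsP.
by rewrite dj eq_sym.
Qed.

(** * The product basis of E *)

Variable y : 'I_n -> E.
Hypotheses (yd : forall j, y j \in grE (dF j)) (iota_y : forall j, iota (y j) = bF`_j).

(** The [mxtens] indexing lets Kronecker products appear literally as matrices of operators in this
    basis. *)
Definition bundle_basis : (m * n).-tuple E :=
  [tuple pi bB`_(mxtens_unindex k).1 * y (mxtens_unindex k).2 | k < m * n].

Definition bundle_degree (k : 'I_(m * n)) : nat :=
  (dB (mxtens_unindex k).1 + dF (mxtens_unindex k).2)%N.

Lemma bundle_basisE (i : 'I_m) (j : 'I_n) :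
  bundle_basis`_(mxtens_index (i, j)) = pi bB`_i * y j.
Proof. by rewrite -tnth_nth tnth_mktuple mxtens_indexK. Qed.

Lemma pi_y_expand beta j :
  pi beta * y j = \sum_k (coord bB (mxtens_unindex k).1 beta *
    (j == (mxtens_unindex k).2)%:R) *: bundle_basis`_k.
Proof.
rewrite {1}(coord_basis bBd.1 (memvf beta)) linear_sum mulr_suml sum_mxtens_index.
apply: eq_bigr => i _; rewrite linearZ -scalerAl (bigD1 j) // big1 => [|j' /negPf jj'].
  by rewrite bundle_basisE mxtens_indexK eqxx mulr1 /= addr0.
by rewrite mxtens_indexK eq_sym jj' mulr0 scale0r.
Qed.

Lemma kernel_decomp v : exists2 c : 'I_n -> R, v - \sum_j c j *: y j \in lker iota
  & iota v = \sum_j c j *: bF`_j.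
Proof.
exists (fun j => coord bF j (iota v)); last exact: coord_basis bFd.1 (memvf _).
rewrite memv_ker linearB linear_sum /= subr_eq0.
rewrite {1}(coord_basis bFd.1 (memvf (iota v))); apply/eqP/eq_bigr => j _.
by rewrite linearZ /= iota_y.
Qed.

(* Graded Nakayama: descending induction on the degree [p] of the coefficient. *)
Lemma bundle_span : (fullv <= <<bundle_basis>>)%VS.
Proof.
have pi_y beta j : pi beta * y j \in <<bundle_basis>>%VS.
  rewrite pi_y_expand; apply: rpred_sum => i _; apply/rpredZ/memv_span/mem_nth.
  by rewrite size_tuple.
have span k p beta v : (b < p + k)%N -> beta \in grB p ->
    pi beta * v \in <<bundle_basis>>%VS.
  elim: k p beta v => [|k IHk] p beta v.
    rewrite addn0 => /(ga_above gB)-> /[!memv0]/eqP->.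
    by rewrite linear0 mul0r mem0v.
  move=> bpk bp; have [c ker_v _] := kernel_decomp v.
  rewrite -[v](subrK (\sum_j c j *: y j)) mulrDr rpredD//; last first.
    rewrite mulr_sumr; apply: rpred_sum => j _.
    by rewrite -scalerAr rpredZ.
  suff /subvP/(_ _ ker_v) : (lker iota <= amull (pi beta) @^-1: <<bundle_basis>>)%VS.
    by rewrite -memv_preim lfunE.
  apply: iota_ker_sub => q beta' w q0 bq; rewrite -memv_preim lfunE /= mulrA -rmorphM.
  by apply: (IHk (p + q)%N); [lia | exact (gr_mul gB bp bq)].
apply/subvP => v _; rewrite -[v]mul1r -(rmorph1 pi).
by apply: (span b.+1 0%N); rewrite ?(ga_gr0 gB) ?memv_line.
Qed.

(** Positive degrees of B die in F, and degree zero consists of scalars. *)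
Lemma iota_pi_scalar beta : iota (pi beta) \in <[1 : F]>%VS.
Proof.
have : beta \in (\sum_(i < b.+1) grB i)%VS by rewrite (ga_full gB) memvf.
case/memv_sumP => bs bsP ->; rewrite !linear_sum; apply: rpred_sum => i _ /=.
have [i0|i0] := posnP i; last first.
  by rewrite -[pi _]mulr1 (iota_pi_eq0 _ i0 (bsP i isT)) mem0v.
have := bsP i isT; rewrite i0 (ga_gr0 gB) => /vlineP[c ->].
by rewrite !linearZ /= !rmorph1; apply/rpredZ/memv_line.
Qed.

(** Let [s] collect the elements of a B-basis that occur in the expansions of the y_j. As B acts on
    F by scalars, their images span F, so n <= size s; by freeness their products with a basis of B
    are linearly independent over R. *)
Lemma bundle_dim : free_module_via pi -> (m * n <= \dim {:E})%N.
Proof.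
case=> S [S_gen S_free].
have y_gen j : exists sc : seq E * (E -> B),
    (forall v, v \in sc.1 -> S v) /\ y j = \sum_(v <- sc.1) pi (sc.2 v) * v.
  by have [s [c [sS yE]]] := S_gen (y j); exists (s, c).
have [sc scP] := fin_all_exists y_gen.
pose s := undup (flatten [seq (sc j).1 | j <- enum 'I_n]).
have s_mem j v : v \in (sc j).1 -> v \in s.
  move=> vj; rewrite mem_undup; apply/flatten_mapP; exists j => //.
  by rewrite mem_enum.
have sS v : v \in s -> S v.
  rewrite mem_undup => /flatten_mapP[j _ vj].
  by have [jS _] := scP j; apply: jS.
have n_le : (n <= size s)%N.
  rewrite -(size_basis bFd.1) -(size_map iota); apply: leq_trans (dim_span _).
  apply/dimvS; rewrite -(span_basis bFd.1); apply/span_subvP => w /(nthP 0)[j].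
  rewrite size_tuple => jn <-.
  rewrite -[j]/(val (Ordinal jn)) -iota_y; have [_ ->] := scP (Ordinal jn).
  rewrite linear_sum big_seq; apply: rpred_sum => v vj; rewrite rmorphM /=.
  have /vlineP[c ->] := iota_pi_scalar ((sc (Ordinal jn)).2 v).
  by rewrite -scalerAl mul1r rpredZ// memv_span// map_f// (s_mem (Ordinal jn)).
apply: leq_trans (leq_mul (leqnn m) n_le) _.
pose h := [tuple pi bB`_(mxtens_unindex k).1 * s`_(mxtens_unindex k).2 | k < m * size s].
suff h_free : free h.
  by rewrite -[X in (X <= _)%N](size_tuple h) -(eqP h_free) dimvS// subvf.
have hE (i : 'I_m) (l : 'I_(size s)) : h`_(mxtens_index (i, l)) = pi bB`_i * s`_l.
  by rewrite -(tnth_nth 0 h) tnth_mktuple mxtens_indexK.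
apply/freeP => c; rewrite sum_mxtens_index.
rewrite exchange_big => sum0.
have s_index (l : 'I_(size s)) : index s`_l s = l by rewrite index_uniq// undup_uniq.
(* Freeness takes coefficients as a function on E: the scalars attached to each element of [s] are
   regrouped into one element of B, with 0 outside [s]. *)
pose cB (v : E) := \sum_i (if insub (index v s) is Some l
   then c (mxtens_index (i, l)) else 0) *: bB`_i.
have cBE (l : 'I_(size s)) : cB s`_l = \sum_i c (mxtens_index (i, l)) *: bB`_i.
  by apply: eq_bigr => i _; rewrite s_index valK.
have cB0 : \sum_(v <- s) pi (cB v) * v = 0.
  rewrite (big_nth 0) big_mkord -[RHS]sum0; apply: eq_bigr => l _.
  rewrite cBE linear_sum mulr_suml; apply: eq_bigr => i _.
  by rewrite hE linearZ -scalerAl.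
move=> k; case: (mxtens_indexP k) => i l.
have := S_free _ _ (undup_uniq _) sS cB0 s`_l (mem_nth _ (ltn_ord l)).
rewrite cBE => cl0.
have /freeP free_bB := basis_free bBd.1.
exact: (free_bB (fun i => c (mxtens_index (i, l)))).
Qed.

Hypothesis pi_free : free_module_via pi.

(** A spanning family whose size is at most the dimension is a basis. *)
Lemma bundle_homogeneous_basis : homogeneous_basis grE bundle_basis bundle_degree.
Proof.
split.
  by rewrite basisEdim bundle_span size_tuple bundle_dim.
move=> k; case: (mxtens_indexP k) => i j.
rewrite bundle_basisE /bundle_degree mxtens_indexK.
by apply: (gr_mul gE); [apply/pi_homogeneous/bBd.2 | apply: yd].
Qed.

Let gE_basis := bundle_homogeneous_basis.

Lemma coord_pi_y beta j i' j' :
  coord bundle_basis (mxtens_index (i', j')) (pi beta * y j) =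
  coord bB i' beta * (j == j')%:R.
Proof.
by rewrite pi_y_expand coord_sum_free ?(basis_free gE_basis.1)// mxtens_indexK.
Qed.

(** Multiplying pi(b_i) y_j by pi(beta) changes only the factor from B, whose degree becomes q + deg
    b_i. *)
Lemma coord_pi_lt q beta v i' j' : beta \in grB q -> (dB i' < q)%N ->
  coord bundle_basis (mxtens_index (i', j')) (pi beta * v) = 0.
Proof.
move=> bq iq; rewrite [v](coord_basis gE_basis.1 (memvf v)) sum_mxtens_index.
rewrite mulr_sumr linear_sum big1// => i _; rewrite mulr_sumr linear_sum big1// => j _.
rewrite -scalerAr linearZ /= bundle_basisE mulrA -rmorphM coord_pi_y.
have /(coords_homogeneous gB bBd)/(_ i') := gr_mul gB bq (bBd.2 i).
rewrite mxE => -> //; first by rewrite mul0r mulr0.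
by rewrite neq_ltn (leq_trans iq (leq_addr _ _)).
Qed.

(** Kernel elements carry a factor from B of positive degree, so the product lives in base degrees
    strictly above [dB i]. *)
Lemma coord_pi_ker v i i' j' : v \in lker iota -> (dB i' <= dB i)%N ->
  coord bundle_basis (mxtens_index (i', j')) (pi bB`_i * v) = 0.
Proof.
move=> ker_v ii'.
pose W := lker (linfun (coord bundle_basis (mxtens_index (i', j')) : E -> R^o)).
suff /subvP/(_ _ ker_v) : (lker iota <= amull (pi bB`_i) @^-1: W)%VS.
  by rewrite -memv_preim memv_ker !lfunE /= => /eqP.
apply: iota_ker_sub => q beta w q0 bq.
rewrite -memv_preim memv_ker !lfunE /= mulrA -rmorphM; apply/eqP.
apply: coord_pi_lt (gr_mul gB (bBd.2 i) bq) _.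
by rewrite -addn1 leq_add.
Qed.

(** * Multiplication by pi(lambda) and x in the product basis *)

Variables (lambda : B) (tau : F) (x : E).
Hypotheses (lambda1 : lambda \in grB 1%N) (x1 : x \in grE 1%N) (iota_x : iota x = tau).

Let L1 := op_mx bundle_basis (amull (pi lambda)).
Let L2 := op_mx bundle_basis (amull x).
Let base_degree (k : 'I_(m * n)) := dB (mxtens_unindex k).1.

Lemma bundle_op_base : L1 = op_mx bB (amull lambda) *t 1%:M.
Proof.
apply/matrixP => k k'; case: (mxtens_indexP k) => i j; case: (mxtens_indexP k') => i' j'.
by rewrite tensmxE !mxE bundle_basisE !lfunE /= mulrA -rmorphM coord_pi_y.
Qed.

(** Modulo the kernel, x y_j is the combination of the y_l with the coordinates of tau bF_j; by
    [coord_pi_ker] the kernel part only reaches base degrees above that of b_i. *)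
Lemma coord_x i j i' j' : (dB i' <= dB i)%N ->
  L2 (mxtens_index (i, j)) (mxtens_index (i', j')) =
  (i == i')%:R * op_mx bF (amull tau) j j'.
Proof.
move=> ii'; rewrite !mxE bundle_basisE !lfunE /=.
have [c ker_v iota_xy] := kernel_decomp (x * y j).
have -> : x * (pi bB`_i * y j) =
    pi bB`_i * (x * y j - \sum_l c l *: y l) + \sum_l c l *: (pi bB`_i * y l).
  rewrite mulrBr (_ : pi bB`_i * \sum_l _ = \sum_l c l *: (pi bB`_i * y l)) ?subrK.
    by rewrite (ga_mulC gE) -mulrA (ga_mulC gE (y j)).
  by rewrite mulr_sumr; apply: eq_bigr => l _; rewrite -scalerAr.
rewrite linearD /= coord_pi_ker// add0r linear_sum (bigD1 j')//= big1 => [|l lj].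
  rewrite linearZ /= coord_pi_y eqxx mulr1 addr0 coord_free ?(basis_free bBd.1)//.
  rewrite mulrC; congr (_ * _).
  have xyE : iota (x * y j) = tau * bF`_j by rewrite rmorphM /= iota_x iota_y.
  by rewrite -xyE iota_xy coord_sum_free ?(basis_free bFd.1).
by rewrite linearZ /= coord_pi_y (negPf lj) !mulr0.
Qed.

Lemma bundle_op_fiber_raises k k' : L2 k k' != 0 -> (base_degree k <= base_degree k')%N.
Proof.
case: (mxtens_indexP k) => i j; case: (mxtens_indexP k') => i' j'.
rewrite /base_degree !mxtens_indexK /=; have [//|lt_ii'] := leqP (dB i) (dB i').
have [ii'|ne_ii'] := eqVneq i i'; first by rewrite ii' ltnn in lt_ii'.
rewrite coord_x 1?ltnW// (negPf ne_ii').
by rewrite mul0r eqxx.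
Qed.

Lemma bundle_op_fiber :
  degree_preserving_part base_degree L2 = 1%:M *t op_mx bF (amull tau).
Proof.
apply/matrixP => k k'; case: (mxtens_indexP k) => i j; case: (mxtens_indexP k') => i' j'.
rewrite tensmxE [LHS]mxE /base_degree !mxtens_indexK /= [1%:M _ _]mxE.
case: eqP => [dii'|dii']; first by rewrite coord_x// dii'.
by case: eqP dii' => [->|_ _]; rewrite ?mul0r.
Qed.

Lemma bundle_op_base_raises : raises_degree base_degree L1.
Proof.
move=> k k'; rewrite bundle_op_base.
case: (mxtens_indexP k) => i j; case: (mxtens_indexP k') => i' j'.
rewrite tensmxE mulf_eq0 negb_or => /andP[/(op_mx_raises gB bBd lambda1) dii' _].
by rewrite /base_degree !mxtens_indexK.
Qed.

(** A nonzero top component forces a basis vector of top degree, and the largest degree in the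
    product basis is b + f. *)
Lemma bundle_top_degree : e = (b + f)%N.
Proof.
have top (A : falgType R) (gr : nat -> {vspace A}) r N (X : N.-tuple A) d :
    graded_artinian gr r -> homogeneous_basis gr X d -> exists i, d i = r.
  move=> gA Xd; have /eqP := ga_top gA; rewrite -subv0 => /subvPn[v vr v0].
  have [/existsP[i /eqP di]|/existsPn no_i] := boolP [exists i, d i == r].
    by exists i.
  case/negP: v0; rewrite memv0 -[v](coordsK Xd.1).
  suff -> : coords X v = 0 by rewrite linear0.
  by apply/rowP => i; rewrite (coords_homogeneous gA Xd vr)// mxE.
apply/eqP; rewrite eqn_leq; apply/andP; split.
  have [k <-] := top _ _ _ _ _ _ gE gE_basis.
  by rewrite leq_add ?(homogeneous_basis_le gB bBd) ?(homogeneous_basis_le gF bFd).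
have [i <-] := top _ _ _ _ _ _ gB bBd; have [j <-] := top _ _ _ _ _ _ gF bFd.
have := homogeneous_basis_le gE gE_basis (mxtens_index (i, j)).
by rewrite /bundle_degree mxtens_indexK.
Qed.

Lemma bundle_lefschetz : lefschetz_element grB b lambda -> lefschetz_element grF f tau ->
  exists t : R, lefschetz_element grE e (pi lambda + t *: x).
Proof.
move=> lefB lefF.
have [fB slB] := lefschetz_element_sl2_pair gB bBd lefB.
have [fF slF] := lefschetz_element_sl2_pair gF bFd lefF.
have slE := sl2_pair_tens slB slF.
rewrite -bundle_op_base -bundle_op_fiber -bundle_top_degree in slE.
(* The tensor pair makes the degenerate operator injective in each degree p <= e / 2 with exponent e
   - 2p; one t serves these finitely many conditions. *)
have [|t tP] := @degeneration_inj _ _ base_degree bundle_degree _ _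
  bundle_op_base_raises bundle_op_fiber_raises e./2.+1 (fun p => e - p.*2)%N.
  move=> p u pe up.
  by apply: (sl2_pair_raise_inj (homogeneous_basis_le gE gE_basis) slE _ up); lia.
exists t; apply: (lefschetz_element_of_inj gE gE_basis _ slE).
  by rewrite rpredD ?rpredZ ?pi_homogeneous.
move=> k p u kpe up.
have -> : op_mx bundle_basis (amull (pi lambda + t *: x)) = L1 + t *: L2.
  apply/matrixP => i j; rewrite !mxE !lfunE /= mulrDl -scalerAl.
  by rewrite linearD linearZ.
rewrite (_ : k = e - p.*2)%N; last by lia.
by apply: tP up; lia.
Qed.

End Bundle.

Theorem theorem2 (R : realType) (B F E : falgType R)
    (grB : nat -> {vspace B}) (grF : nat -> {vspace F})
    (grE : nat -> {vspace E}) (b f e : nat) (lambda : B) (tau : F)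
    (pi : 'AHom(B, E)) (iota : 'AHom(E, F)) :
  lefschetz_algebra grB b lambda ->
  lefschetz_algebra grF f tau ->
  graded_artinian grE e ->
  graded_hom grB grE pi ->
  graded_hom grE grF iota ->
  free_module_via pi ->
  limg iota = fullv ->
  lker iota = extended_positive_ideal grB b pi ->
  forall x : E, x \in grE 1%N -> iota x = tau ->
  exists t : R, lefschetz_algebra grE e (pi lambda + t *: x).
Proof.
move=> [gB lefB] [gF lefF] gE piG iotaG free_pi surj ker x x1 iota_x.
have [m [bB [dB bBd]]] := exists_homogeneous_basis gB.
have [n [bF [dF bFd]]] := exists_homogeneous_basis gF.
have lifts (j : 'I_n) : exists v, v \in grE (dF j) /\ iota v = bF`_j.
  by have [v] := iota_lift gF gE iotaG surj bFd (bFd.2 j); exists v.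
have [y yP] := fin_all_exists lifts.
have yd j : y j \in grE (dF j) by case: (yP j).
have iota_y j : iota (y j) = bF`_j by case: (yP j).
have [t lefE] := bundle_lefschetz gB gF gE piG ker bBd bFd yd iota_y free_pi
  lefB.1 x1 iota_x lefB lefF.
by exists t.
Qed.
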